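(* Let $(\mathfrak g,H,\mathcal G_g)$ be a four-dimensional generalised Lorentzian Lie algebra, $E=\mathfrak g\oplus\mathfrak g^*$, and let $(e_1,\dots,e_4)$ be an orthonormal basis of $\mathfrak g$ with dual basis $(e^1,\dots,e^4)$. Let $a\in\mathbb R\setminus\{0\}$, $\epsilon\in\{-1,1\}$, $H=a\,e^{123}$ and $\delta\in E^*$. In each case below only the listed brackets (up to anti-symmetry) are non-zero. (a) Suppose $g(e_4,e_4)=-1$, $g(e_i,e_i)=1$ for $i=1,2,3$, and $[e_1,e_2]=\epsilon a\,e_3$, $[e_2,e_3]=\epsilon a\,e_1$, $[e_3,e_1]=\epsilon a\,e_2$, $[e_3,e_4]=b\,e_2$, $[e_4,e_2]=b\,e_3$ with $b\in\mathbb R$. Then $(\mathfrak g,H,\mathcal G_g,\delta)$ is generalised Einstein if and only if either $b\ne0$, $\delta(e_2)=\delta(e_3)=\delta(e^2)=\delta(e^3)=0$ and $\delta(e_1+\epsilon\,e^1)=0$, or $b=0$ and $\delta(e_i+\epsilon\,e^i)=0$ for $i=1,2,3$. In (b)–(d) suppose $g(e_1,e_1)=-1$, $g(e_i,e_i)=1$ for $i=2,3,4$, and $[e_1,e_2]=\epsilon a\,e_3$, $[e_2,e_3]=-\epsilon a\,e_1$, $[e_3,e_1]=\epsilon a\,e_2$. (b) Suppose in addition $[e_4,e_2]=b\,e_3$, $[e_4,e_3]=-b\,e_2$ with $b\in\mathbb R$. Then $(\mathfrak g,H,\mathcal G_g,\delta)$ is generalised Einstein if and only if either $b\ne0$, $\delta(e_2)=\delta(e_3)=\delta(e^2)=\delta(e^3)=0$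 and $\delta(e_1-\epsilon\,e^1)=0$, or $b=0$, $\delta(e_i+\epsilon\,e^i)=0$ for $i=2,3$ and $\delta(e_1-\epsilon\,e^1)=0$. (c) Suppose in addition $[e_4,e_1]=b\,e_2$, $[e_4,e_2]=b\,e_1$ with $b\in\mathbb R\setminus\{0\}$. Then $(\mathfrak g,H,\mathcal G_g,\delta)$ is generalised Einstein if and only if $\delta(e_1)=\delta(e_2)=\delta(e^1)=\delta(e^2)=0$ and $\delta(e_3+\epsilon\,e^3)=0$. (d) Suppose in addition $[e_4,e_1]=e_2$, $[e_4,e_2]=e_1+e_3$, $[e_4,e_3]=-e_2$. Then $(\mathfrak g,H,\mathcal G_g,\delta)$ is generalised Einstein if and only if $\delta(e_2)=\delta(e^2)=0$, $\delta(e_3)=-\delta(e_1)$, $\delta(e^3)=\delta(e^1)$ and $\delta(e_1-\epsilon\,e^1)=0$.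
   Context: Let $\mathfrak g$ be a finite-dimensional real Lie algebra. A generalised pseudo-Riemannian metric on $\mathfrak g$ is a pair $(H,\mathcal G_g)$ where $H\in\Lambda^3\mathfrak g^*$ is closed for the Chevalley–Eilenberg differential (normalised by $d\alpha(X,Y)=-\alpha([X,Y])$), $g$ is a non-degenerate symmetric bilinear form on $\mathfrak g$, and $\mathcal G_g$ is the endomorphism of $E=\mathfrak g\oplus\mathfrak g^*$ given by $\mathcal G_g(X+\xi)=\xi^\sharp+X^\flat$, with $X^\flat=g(X,\cdot)$ and $\sharp=\flat^{-1}$; it is Lorentzian if $g$ has signature $(n-1,1)$, $n=\dim\mathfrak g$. Let $E_\pm=\{X\pm X^\flat\mid X\in\mathfrak g\}$ be the $\pm1$-eigenspaces of $\mathcal G_g$ and $\pi_\pm=\frac12(\mathrm{id}\pm\mathcal G_g):E\to E_\pm$. The $H$-twisted Dorfman bracket on $E$ is $[X+\xi,Y+\eta]_H=[X,Y]+d\eta(X,\cdot)-d\xi(Y,\cdot)+H(X,Y,\cdot)$. A divergence operator is an element $\delta\in E^*$. For $u\in E_+$, $v\in E_-$ put $\Gamma_u=\pi_+\circ[u,\cdot]_H|_{E_-}:E_-\to E_+$ and $\Gamma_v=\pi_-\circ[v,\cdot]_H|_{E_+}:E_+\to E_-$. The generalised Ricci curvatures of $(\mathcal G_g,\delta)$ are, by a known result taken here as definition, $\mathcal{RC}^+(v,u)=-\mathrm{tr}(\Gamma_v\circ\Gamma_u)+\delta(\pi_+[v,u]_H)$ and $\mathcal{RC}^-(u,v)=-\mathrm{tr}(\Gamma_v\circ\Gamma_u)+\delta(\pi_-[u,v]_H)$.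 The quadruple $(\mathfrak g,H,\mathcal G_g,\delta)$ is generalised Einstein if $\mathcal{RC}^+=0$ and $\mathcal{RC}^-=0$ (for all $u\in E_+$, $v\in E_-$). $e^{123}=e^1\wedge e^2\wedge e^3$. *)

(* Defs.v *)
From HB Require Import structures.
From mathcomp Require Import all_boot all_algebra ring.

Set Implicit Arguments.
Unset Strict Implicit.
Unset Printing Implicit Defensive.

Import GRing.Theory.
Local Open Scope ring_scope.

HB.mixin Record isLieAlgebra (R : fieldType) V of Vector R V := {
  lie : V -> V -> V;
  lie_linearl : forall y, linear (lie^~ y);
  lie_linearr : forall x, linear (lie x);
  liexx : forall x, lie x x = 0;
  lie_jacobi : forall x y z,
    lie x (lie y z) + lie y (lie z x) + lie z (lie x y) = 0
}.

#[short(type="lieAlgType")]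
HB.structure Definition LieAlgebra (R : fieldType) :=
  { V of Vector R V & isLieAlgebra R V }.

Notation dual V := 'Hom(V, _^o).
Notation dbl V := (V * dual V)%type.

Section LinearAlgebra.
Variables (F : fieldType) (V : vectType F).

(* [linfun f] is only meaningful for a linear [f]; below, each use of [linfun]
   comes with a lemma stating that it computes the intended map. *)
Lemma linfunE (W : vectType F) (f : V -> W) :
  linear f -> forall x, linfun f x = f x.
Proof.
move=> f_linear x.
pose m := GRing.isLinear.Build F V W *:%R f f_linear.
pose f' : {linear V -> W} := HB.pack f m.
exact: (lfunE f').
Qed.

Definition lftrace (f : 'End(V)) : F :=
  \tr (passmx.mxof (vbasis {:V}) (vbasis {:V}) f).

Definition is_dual_basis (e : seq V) (f : seq (dual V)) : Prop :=
  size f = size e /\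
  forall i j, (i < size e)%N -> (j < size e)%N -> f`_i e`_j = (i == j)%:R.

Record form3 := Form3 {
  form3_fun :> V -> V -> V -> F;
  form3_linear1 : forall y z, scalar (fun x => form3_fun x y z);
  form3_linear2 : forall x z, scalar (fun y => form3_fun x y z);
  form3_linear3 : forall x y, scalar (fun z => form3_fun x y z);
  form3_alt12 : forall x y, form3_fun x x y = 0;
  form3_alt23 : forall x y, form3_fun x y y = 0
}.

(* The determinant convention, without the factor 1/3!. *)
Definition wedge3 (f1 f2 f3 : dual V) (x y z : V) : F :=
  \det (\matrix_(i < 3, j < 3)
    (tnth [tuple f1; f2; f3] i) (tnth [tuple x; y; z] j)).

(* The library's [orthonormal] does not fit: it requires g x x = 1 throughout. *)
Definition pseudo_orthonormal (g : {symmetric V}) (e : seq V) : Prop :=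
  (forall x, x \in e -> g x x = 1 \/ g x x = -1) /\
  (forall i j, (i < size e)%N -> (j < size e)%N -> i <> j ->
     g e`_i e`_j = 0).

Definition has_signature (g : {symmetric V}) (p q : nat) : Prop :=
  exists2 e : (p + q).-tuple V, basis_of {:V} e &
    forall i j : 'I_(p + q), g (tnth e i) (tnth e j) =
      if i == j then (if (i < p)%N then 1 else -1) else 0.

Definition lorentzian (g : {symmetric V}) : Prop :=
  has_signature g (\dim {:V}).-1 1.

End LinearAlgebra.

Section GeneralisedMetric.
Variables (F : fieldType) (V : vectType F) (g : {symmetric V}).

Definition flat : 'Hom(V, dual V) :=
  linfun (fun x => linfun (g x : V -> F^o) : dual V).

Lemma flatE x y : flat x y = g x y.
Proof.
have g_linear z : linear (g z : V -> F^o) by move=> k u v; rewrite linearP.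
rewrite /flat linfunE ?linfunE // => k u v.
apply/lfunP => z; rewrite add_lfunE scale_lfunE !linfunE //.
by rewrite linearPl.
Qed.

(* The inverse of [flat] when g is non-degenerate. *)
Definition sharp : 'Hom(dual V, V) := (flat^-1)%VF.

Lemma flatK : nondegenerate g -> cancel flat sharp.
Proof.
move=> /eqP g_nondeg x; apply: lker0_lfunK.
rewrite -subv0 -g_nondeg; apply/subvP => {}x.
rewrite memv_ker => /eqP flatx0; apply/mem_orthovP => y _.
by rewrite -flatE flatx0 zero_lfunE.
Qed.

Lemma sharpK : nondegenerate g -> cancel sharp flat.
Proof.
move=> /flatK flatKg xi; apply: limg_lfunVK.
suff -> : limg flat = fullv by rewrite memvf.
apply/eqP; rewrite eqEdim subvf limg_dim_eq.
  have -> : \dim {:dual V} = (\dim {:V} * 1)%N.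
    by rewrite dimvf dimvf; reflexivity.
  by rewrite muln1; exact: leqnn.
have /eqP -> : lker flat == 0%VS.
  by apply/lker0P => u v /(congr1 sharp); rewrite !flatKg.
by rewrite capv0.
Qed.

Definition genmetric : 'End(dbl V) :=
  linfun (fun u : dbl V => (sharp u.2, flat u.1) : dbl V).

Lemma genmetricE u : genmetric u = (sharp u.2, flat u.1).
Proof. by rewrite linfunE // => k [x xi] [y eta] /=; rewrite !linearP. Qed.

Definition Eplus : {vspace dbl V} :=
  limg (linfun (fun x => (x, flat x) : dbl V)).
Definition Eminus : {vspace dbl V} :=
  limg (linfun (fun x => (x, - flat x) : dbl V)).

Lemma EplusP u : reflect (exists x, u = (x, flat x)) (u \in Eplus).
Proof.
have gr_linear : linear (fun x => (x, flat x) : dbl V).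
  by move=> k x y; apply/eqP; rewrite xpair_eqE /= linearP !eqxx.
apply: (iffP memv_imgP) => [[x _ ->]|[x ->]].
  by exists x; rewrite [LHS]linfunE.
by exists x; [exact: memvf | rewrite [RHS]linfunE].
Qed.

Lemma EminusP u : reflect (exists x, u = (x, - flat x)) (u \in Eminus).
Proof.
have gr_linear : linear (fun x => (x, - flat x) : dbl V).
  by move=> k x y; apply/eqP; rewrite xpair_eqE /= linearP opprD -scalerN !eqxx.
apply: (iffP memv_imgP) => [[x _ ->]|[x ->]].
  by exists x; rewrite [LHS]linfunE.
by exists x; [exact: memvf | rewrite [RHS]linfunE].
Qed.

(* [vsproj] only restricts the codomain: when g is non-degenerate,
   (id +- G)/2 already takes its values in Eplus, resp. Eminus. *)
Definition piplus (u : dbl V) : subvs_of Eplus :=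
  vsproj Eplus (2^-1 *: (u + genmetric u)).
Definition piminus (u : dbl V) : subvs_of Eminus :=
  vsproj Eminus (2^-1 *: (u - genmetric u)).

Lemma piplus_linear : linear piplus.
Proof.
move=> k u v; rewrite /piplus -linearP; congr (vsproj _ _).
rewrite (linearP genmetric) addrACA -scalerDr [LHS]scalerDr !scalerA.
by rewrite [k * _]mulrC.
Qed.

Lemma piminus_linear : linear piminus.
Proof.
move=> k u v; rewrite /piminus -linearP; congr (vsproj _ _).
rewrite (linearP genmetric) opprD addrACA -scalerBr [LHS]scalerDr !scalerA.
by rewrite [k * _]mulrC.
Qed.

Lemma piplusE u : nondegenerate g ->
  vsval (piplus u) = 2^-1 *: (u + genmetric u).
Proof.
move=> g_nondeg; rewrite vsprojK //; apply/EplusP.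
exists (2^-1 *: (u.1 + sharp u.2)); case: u => x xi.
have -> : flat (2^-1 *: (x + sharp xi)) = 2^-1 *: (xi + flat x).
  by rewrite linearZ; congr (_ *: _); rewrite raddfD /= sharpK //; exact: addrC.
by rewrite genmetricE.
Qed.

Lemma piminusE u : nondegenerate g ->
  vsval (piminus u) = 2^-1 *: (u - genmetric u).
Proof.
move=> g_nondeg; rewrite vsprojK //; apply/EminusP.
exists (2^-1 *: (u.1 - sharp u.2)); case: u => x xi.
have -> : - flat (2^-1 *: (x - sharp xi)) = 2^-1 *: (xi - flat x).
  by rewrite linearZ -scalerN; congr (_ *: _); rewrite raddfB /= sharpK // opprB.
by rewrite genmetricE.
Qed.

End GeneralisedMetric.

Section DorfmanBracket.
Variables (F : fieldType) (V : lieAlgType F) (H : form3 V).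

Definition ce_diff1 (f : dual V) (x y : V) : F := - f (lie x y).

(* sum over i < j of (-1)^(i+j) H([x_i, x_j], ..) *)
Definition ce_diff3 (x0 x1 x2 x3 : V) : F :=
  - H (lie x0 x1) x2 x3 + H (lie x0 x2) x1 x3 - H (lie x0 x3) x1 x2
  - H (lie x1 x2) x0 x3 + H (lie x1 x3) x0 x2 - H (lie x2 x3) x0 x1.

Definition closed3 : Prop := forall x0 x1 x2 x3, ce_diff3 x0 x1 x2 x3 = 0.

Definition dorfman (u v : dbl V) : dbl V :=
  (lie u.1 v.1,
   linfun (fun z => ce_diff1 v.2 u.1 z - ce_diff1 u.2 v.1 z + H u.1 v.1 z
             : F^o)).

Lemma dorfman2E u v z :
  (dorfman u v).2 z = ce_diff1 v.2 u.1 z - ce_diff1 u.2 v.1 z + H u.1 v.1 z.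
Proof.
rewrite linfunE // => k x y; rewrite /ce_diff1 !lie_linearr !linearP /=.
rewrite form3_linear3 -![_ *: _]/(_ * _).
ring.
Qed.

Lemma dorfman_linear u : linear (dorfman u).
Proof.
move=> k v w; apply: injective_projections.
  by rewrite /= lie_linearr.
apply/lfunP => z; rewrite (dorfman2E u (k *: v + w) z).
rewrite [RHS]add_lfunE [X in _ = X + _]scale_lfunE !dorfman2E /ce_diff1 /=.
have /= -> := form3_linear2 H u.1 z k v.1 w.1.
rewrite add_lfunE scale_lfunE.
have /= -> := lie_linearl z k v.1 w.1; rewrite (linearP u.2).
have key (a b c a' b' c' : F) : - (k * a + a') - - (k * b + b') + (k * c + c')
  = k * (- a - - b + c) + (- a' - - b' + c') by ring.
exact: key.
Qed.

End DorfmanBracket.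

Section GeneralisedRicci.
Variables (F : fieldType) (V : lieAlgType F) (H : form3 V).
Variables (g : {symmetric V}) (delta : dual (dbl V)).

Let Ep := subvs_of (Eplus g).
Let Em := subvs_of (Eminus g).

Definition Gamma_plus (u : Ep) : 'Hom(Em, Ep) :=
  linfun (fun w : Em => piplus g (dorfman H (vsval u) (vsval w))).
Definition Gamma_minus (v : Em) : 'Hom(Ep, Em) :=
  linfun (fun w : Ep => piminus g (dorfman H (vsval v) (vsval w))).

Lemma Gamma_plusE u w :
  Gamma_plus u w = piplus g (dorfman H (vsval u) (vsval w)).
Proof.
rewrite linfunE // => k x y.
by rewrite (linearP vsval) dorfman_linear piplus_linear.
Qed.

Lemma Gamma_minusE v w :
  Gamma_minus v w = piminus g (dorfman H (vsval v) (vsval w)).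
Proof.
rewrite linfunE // => k x y.
by rewrite (linearP vsval) dorfman_linear piminus_linear.
Qed.

Definition RCplus (v : Em) (u : Ep) : F :=
  - lftrace (Gamma_minus v \o Gamma_plus u)%VF
  + delta (vsval (piplus g (dorfman H (vsval v) (vsval u)))).
Definition RCminus (u : Ep) (v : Em) : F :=
  - lftrace (Gamma_minus v \o Gamma_plus u)%VF
  + delta (vsval (piminus g (dorfman H (vsval u) (vsval v)))).

Definition gen_pseudo_riemannian : Prop := closed3 H /\ nondegenerate g.

Definition gen_lorentzian : Prop := gen_pseudo_riemannian /\ lorentzian g.

Definition gen_einstein : Prop :=
  (forall v u, RCplus v u = 0) /\ (forall u v, RCminus u v = 0).

End GeneralisedRicci.

(* Main.v *)
(* In all four families write D = ad e4 and L for the bracket of the first three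
   basis vectors, extended by 0 to e4.  Then D is g-skew, the image of every
   bracket lies in span(e1,e2,e3) = ker e^4, and H(x,y,z) = eps g(L(x,y),z).
   With x^+- = x +- flat x this gives
     pi_+ [x^+, y^-] = ((1+eps)/2 L(x,y) - e^4(y) D x)^+,
     pi_- [y^-, x^+] = ((1-eps)/2 L(y,x) - e^4(x) D y)^-,
   and since (1+eps)(1-eps) = 0, the endomorphism Gamma_v o Gamma_u has the form
   w |-> e^4(w) c with c in ker e^4, so its trace vanishes.  What remains of the
   Einstein equations is that delta vanishes on z + eps flat z for z = L(x,y)
   and on both z and flat z for z in the image of D. *)
Require Import Defs.
From HB Require Import structures.
From mathcomp Require Import all_boot all_algebra ring.
From mathcomp Require Import reals.

Set Implicit Arguments.
Unset Strict Implicit.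
Unset Printing Implicit Defensive.

Import GRing.Theory.
Local Open Scope ring_scope.

(** * Preliminaries on traces, linear forms and the wedge product *)

Lemma lftrace_rank1 (F : fieldType) (V : vectType F) (f : 'End(V))
    (phi : {linear V -> F^o}) (c : V) :
  (forall x, f x = (phi x : F) *: c) -> lftrace f = phi c.
Proof.
move=> fE; have basisV := vbasisP {:V}.
(* With [c] expanded in the basis, [phi c] is the sum of the products of the coordinates of [c] with
   the values of [phi] on the basis, and these products are the diagonal entries of the matrix of
   [f]. *)
rewrite [in RHS](coord_basis basisV (memvf c)) linear_sum /lftrace /mxtrace.
apply: eq_bigr => i _; rewrite linearZ /= [RHS]mulrC !mxE /=.
by rewrite passmx.vecof_delta fE linearZ.
Qed.

(* The values of a linear form live in [F^o], whose module structure hides the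
   ring operations of [F] from rewriting; hence these restatements. *)
Section DualLinear.
Variables (F : fieldType) (V : vectType F) (f : dual V).

Lemma dualZ k x : f (k *: x) = k * f x :> F. Proof. by rewrite linearZ. Qed.
Lemma dualD x y : f (x + y) = f x + f y :> F. Proof. by rewrite linearD. Qed.
Lemma dualN x : f (- x) = - f x :> F. Proof. by rewrite linearN. Qed.
Lemma dualB x y : f (x - y) = f x - f y :> F. Proof. by rewrite linearB. Qed.
Lemma dual0 : f 0 = 0 :> F. Proof. by rewrite linear0. Qed.
Definition dualE := (dual0, dualB, dualD, dualN, dualZ).

End DualLinear.

Lemma wedge3E (F : fieldType) (V : vectType F) (f1 f2 f3 : dual V) x y z :
  wedge3 f1 f2 f3 x y z =
    f1 x * (f2 y * f3 z - f2 z * f3 y) - f1 y * (f2 x * f3 z - f2 z * f3 x)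
    + f1 z * (f2 x * f3 y - f2 y * f3 x).
Proof.
rewrite /wedge3 (expand_det_row _ ord0) !big_ord_recl big_ord0 /cofactor.
rewrite !(expand_det_row _ ord0) !big_ord_recl !big_ord0 /cofactor !det_mx11.
rewrite !mxE /= !(tnth_nth 0) /=.
ring.
Qed.

Lemma dual_pairE (F : fieldType) (V : vectType F) (delta : dual (dbl V))
    x k xi : delta (x, k *: xi) = delta (x, 0) + k * delta (0, xi) :> F.
Proof.
rewrite -dualZ -dualD; congr (delta _).
by apply: injective_projections; rewrite /= ?scaler0 ?addr0 ?add0r.
Qed.

(** * Bilinearity and antisymmetry of the brackets and of 3-forms *)

Section LieForm.
Variables (F : fieldType) (V : lieAlgType F) (H : form3 V).

Lemma lieDl (x y z : V) : lie (x + y) z = lie x z + lie y z.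
Proof. by have := lie_linearl z 1 x y; rewrite /= !scale1r. Qed.

Lemma lieDr (x y z : V) : lie z (x + y) = lie z x + lie z y.
Proof. by have := lie_linearr z 1 x y; rewrite /= !scale1r. Qed.

Lemma lie0r (x : V) : lie x 0 = 0.
Proof. by apply: (addrI (lie x 0)); rewrite -lieDr !addr0. Qed.

Lemma lieZr k (x y : V) : lie y (k *: x) = k *: lie y x.
Proof. by have := lie_linearr y k x 0; rewrite /= lie0r !addr0. Qed.

Lemma lieZl k (x y : V) : lie (k *: x) y = k *: lie x y.
Proof.
have lie0l : lie 0 y = 0 by apply: (addrI (lie 0 y)); rewrite -lieDl !addr0.
by have := lie_linearl y k x 0; rewrite /= lie0l !addr0.
Qed.

Lemma lieC (x y : V) : lie x y = - lie y x.
Proof.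
have := liexx (x + y); rewrite lieDl !lieDr !liexx add0r addr0 => /eqP.
by rewrite addr_eq0 => /eqP.
Qed.

Lemma form3C12 x y z : H x y z = - H y x z.
Proof.
have := form3_alt12 H (x + y) z.
have D1 (u v w : V) : H (u + v) w z = H u w z + H v w z.
  by have := form3_linear1 H w z 1 u v; rewrite scale1r mul1r.
have D2 (u v w : V) : H w (u + v) z = H w u z + H w v z.
  by have := form3_linear2 H w z 1 u v; rewrite scale1r mul1r.
rewrite D1 !D2 !form3_alt12 add0r addr0 => /eqP.
by rewrite addr_eq0 => /eqP.
Qed.

Lemma form3C23 x y z : H x y z = - H x z y.
Proof.
have := form3_alt23 H x (y + z).
have D1 (u v w : V) : H x (u + v) w = H x u w + H x v w.
  by have := form3_linear2 H x w 1 u v; rewrite scale1r mul1r.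
have D2 (u v w : V) : H x w (u + v) = H x w u + H x w v.
  by have := form3_linear3 H x w 1 u v; rewrite scale1r mul1r.
rewrite D1 !D2 !form3_alt23 add0r addr0 => /eqP.
by rewrite addr_eq0 => /eqP.
Qed.

(** In general the symmetric part of a Dorfman bracket is the differential of the pairing. Over a
    Lie algebra the pairing is constant, so the bracket is skew. *)
Lemma dorfmanC (u v : dbl V) : dorfman H u v = - dorfman H v u.
Proof.
apply: injective_projections => /=; first exact: lieC.
apply/lfunP => z; rewrite opp_lfunE (dorfman2E H u v z) (dorfman2E H v u z).
by rewrite (form3C12 u.1) opprD opprB.
Qed.

End LieForm.

(** * Projections to the eigenspaces of the generalised metric *)

Section Projections.
Variables (F : fieldType) (V : vectType F) (g : {symmetric V}).
Hypotheses (two_neq0 : (2 : F) != 0) (g_nondeg : nondegenerate g).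

Lemma nondegenerate_inj x y : (forall w, g x w = g y w) -> x = y.
Proof.
move=> gxy; apply: (can_inj (flatK g_nondeg)).
by apply/lfunP => w; rewrite !flatE.
Qed.

(** Pairing with an arbitrary [w] turns the vector part, half of [u.1 + sharp u.2], into an
    expression without [sharp], so the projection can be found by computing scalars. *)
Lemma vsval_piplus (u : dbl V) z :
  (forall w, g u.1 w + u.2 w = 2 * g z w) ->
  vsval (piplus g u) = (z, flat g z).
Proof.
move=> uz; rewrite piplusE // genmetricE.
have u2E : u.2 = flat g (2 *: z - u.1).
  apply/lfunP => w; rewrite flatE linearBl linearZl /= -uz.
  ring.
case: u => u1 u2 /= in uz u2E *.
rewrite u2E flatK //; apply: injective_projections => /=.
  by rewrite addrC subrK scalerA mulVf ?scale1r.
by rewrite linearB /= subrK linearZ /= scalerA mulVf ?scale1r.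
Qed.

Lemma vsval_piminus (u : dbl V) z :
  (forall w, g u.1 w - u.2 w = 2 * g z w) ->
  vsval (piminus g u) = (z, - flat g z).
Proof.
move=> uz; rewrite piminusE // genmetricE.
have u2E : u.2 = flat g (u.1 - 2 *: z).
  apply/lfunP => w; rewrite flatE linearBl linearZl /= -uz.
  ring.
case: u => u1 u2 /= in uz u2E *.
rewrite u2E flatK //; apply: injective_projections => /=.
  by rewrite opprB addrC subrK scalerA mulVf ?scale1r.
have -> : flat g (u1 - 2 *: z) = flat g u1 - 2 *: flat g z.
  by rewrite linearB; congr (_ - _); rewrite linearZ.
by rewrite addrAC subrr add0r scalerN scalerA mulVf ?scale1r.
Qed.

End Projections.

(** * Projected Dorfman brackets for a skew derivation [lie t] *)

Section Ricci.
Variables (F : fieldType) (V : lieAlgType F) (H : form3 V) (g : {symmetric V}).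
Variables (eps : F) (t : V) (eta : dual V) (delta : dual (dbl V)).

(* The bracket with the contribution of [t] removed: a multiple of the vector
   product of the kernel of [eta], extended by 0 to [t]. *)
Definition cross (x y : V) : V :=
  lie x y - (eta x : F) *: lie t y + (eta y : F) *: lie t x.

Hypotheses (two_neq0 : (2 : F) != 0) (g_nondeg : nondegenerate g).
Hypothesis eps2 : eps * eps = 1.
Hypothesis H_cross : forall x y z, H x y z = eps * g (cross x y) z.
Hypothesis skew : forall x y, g (lie t x) y = - g x (lie t y).
Hypothesis eta_lie : forall x y, eta (lie x y) = 0.
Hypothesis eta_t : eta t = 1.

Definition Gplus (x y : V) : V :=
  ((1 + eps) / 2) *: cross x y - (eta y : F) *: lie t x.
Definition Gminus (y x : V) : V :=
  ((1 - eps) / 2) *: cross y x - (eta x : F) *: lie t y.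

(** Inverting the definition of [cross] writes each bracket as an alternating term plus terms in the
    skew map D = [lie t]. *)
Lemma g_lie x y z : g (lie x y) z =
  eps * H x y z + (eta x : F) * g (lie t y) z - (eta y : F) * g (lie t x) z.
Proof.
rewrite H_cross mulrA eps2 mul1r /cross linearDl linearBl !linearZl /=.
ring.
Qed.

Lemma g_cross x y z : g (cross x y) z = eps * H x y z.
Proof. by rewrite H_cross mulrA eps2 mul1r. Qed.

Lemma g_sym x y : g x y = g y x.
Proof. by rewrite hermC expr0 mul1r. Qed.

(** Paired with [w], the three brackets contribute [eps * H x y w] with signs +, -, +, and the twist
    adds [H x y w]. Skewness of D cancels its terms except for two equal ones with factor
    [eta y]. *)
Lemma piplus_dorfman x y :
  vsval (piplus g (dorfman H (x, flat g x) (y, - flat g y))) =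
  (Gplus x y, flat g (Gplus x y)).
Proof.
apply: vsval_piplus => // w.
rewrite (dorfman2E H (x, flat g x) (y, - flat g y)) /= /ce_diff1.
rewrite opp_lfunE !flatE.
rewrite 2![g _ (lie _ _)]g_sym (g_lie x y) (g_lie x w) (g_lie y w).
rewrite (form3C23 H x w) (form3C12 H y w) (form3C23 H w y) (form3C12 H w x).
rewrite (form3C23 H x w) /Gplus linearBl !linearZl /= g_cross.
rewrite !(skew w) (skew y x) !(g_sym w) (g_sym y).
(* This exposes [eps * eps], so that [eps2] gives (1 + eps) eps = 1 + eps. *)
have -> : (1 + eps) / 2 * (eps * H x y w) = (eps + eps * eps) * H x y w / 2.
  by field.
by rewrite eps2; field.
Qed.

Lemma piminus_dorfman y x :
  vsval (piminus g (dorfman H (y, - flat g y) (x, flat g x))) =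
  (Gminus y x, - flat g (Gminus y x)).
Proof.
apply: vsval_piminus => // w.
rewrite (dorfman2E H (y, - flat g y) (x, flat g x)) /= /ce_diff1.
rewrite opp_lfunE !flatE.
rewrite 2![g _ (lie _ _)]g_sym (g_lie y x) (g_lie y w) (g_lie x w).
rewrite (form3C23 H y w) (form3C12 H x w) (form3C23 H w x) (form3C12 H w y).
rewrite (form3C23 H y w) /Gminus linearBl !linearZl /= g_cross.
rewrite !(skew w) (skew x y) !(g_sym w) (g_sym x).
have -> : (1 - eps) / 2 * (eps * H y x w) = (eps - eps * eps) * H y x w / 2.
  by field.
by rewrite eps2; field.
Qed.

Lemma eta_cross x y : eta (cross x y) = 0.
Proof. by rewrite /cross !dualE !eta_lie; ring. Qed.

Lemma eta_Gplus x y : eta (Gplus x y) = 0.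
Proof. by rewrite dualB !dualZ eta_cross eta_lie; ring. Qed.

(** Linearity is inherited from [H], which represents [cross] through [g]. *)
Lemma crossBr x y z : cross x (y - z) = cross x y - cross x z.
Proof.
apply: (nondegenerate_inj g_nondeg) => w.
rewrite [RHS]linearBl /= !g_cross.
have /= := form3_linear2 H x w (- 1) z y.
by rewrite scaleN1r mulN1r [- z + y]addrC => ->; ring.
Qed.

Lemma crossZr k x y : cross x (k *: y) = k *: cross x y.
Proof.
by rewrite /cross !lieZr dualZ !scalerDr scalerN !scalerA [k * eta x]mulrC.
Qed.

(** * The trace term of the Ricci curvatures *)

Let ep x : subvs_of (Eplus g) := vsproj (Eplus g) (x, flat g x).
Let em x : subvs_of (Eminus g) := vsproj (Eminus g) (x, - flat g x).

Let val_ep x : vsval (ep x) = (x, flat g x).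
Proof. by apply: vsprojK; apply/EplusP; exists x. Qed.

Let val_em x : vsval (em x) = (x, - flat g x).
Proof. by apply: vsprojK; apply/EminusP; exists x. Qed.

Let ep_onto u : exists x, u = ep x.
Proof.
case/EplusP: (subvsP u) => x ux; exists x.
by apply: val_inj; rewrite /= [RHS]val_ep.
Qed.

Let em_onto v : exists x, v = em x.
Proof.
case/EminusP: (subvsP v) => x vx; exists x.
by apply: val_inj; rewrite /= [RHS]val_em.
Qed.

Lemma lftrace_Gamma (u : subvs_of (Eplus g)) (v : subvs_of (Eminus g)) :
  lftrace (Gamma_minus H v \o Gamma_plus H u)%VF = 0.
Proof.
have [x ->] := ep_onto u; have [y ->] := em_onto v.
(* In [Gminus y (Gplus x z)] the D term vanishes because [eta] kills [Gplus x z], and the double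
   [cross] term has the factor (1 - eps)(1 + eps) = 0. The rest is [eta z] times this vector. *)
pose c : subvs_of (Eminus g) :=
  em (- (((1 - eps) / 2) *: cross y (lie t x))).
have phiP : linear (fun w : subvs_of (Eminus g) => eta (vsval w).1).
  by move=> k w1 w2; rewrite !linearP.
rewrite (@lftrace_rank1 _ _ _
  (linfun (fun w : subvs_of (Eminus g) => eta (vsval w).1)) c).
  rewrite /= linfunE // val_em /= dualN dualZ eta_cross mulr0 oppr0.
  reflexivity.
move=> w; have [z ->] := em_onto w.
rewrite comp_lfunE Gamma_plusE Gamma_minusE /= linfunE // !val_em !val_ep.
rewrite piplus_dorfman.
apply: val_inj.
rewrite /= piminus_dorfman val_em.
have -> : Gminus y (Gplus x z) =
    (eta z : F) *: - (((1 - eps) / 2) *: cross y (lie t x)).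
  rewrite /Gminus eta_Gplus scale0r subr0 /Gplus crossBr !crossZr.
  rewrite scalerBr !scalerA.
  have -> : (1 - eps) / 2 * ((1 + eps) / 2) = 0.
    by rewrite mulrACA -subr_sqr expr1n expr2 eps2 subrr mul0r.
  by rewrite scale0r sub0r scalerN mulrC scalerA.
apply: injective_projections => //=.
by rewrite linearZ scalerN.
Qed.

(** * The Einstein equations as conditions on [delta] *)

Let RCplusE x y : RCplus H delta (em y) (ep x) =
  - delta (Gplus x y, flat g (Gplus x y)).
Proof.
(* [RCplus] projects the bracket of [v] with [u], whereas [piplus_dorfman] has the opposite order;
   [dorfmanC] produces the minus sign. *)
rewrite /RCplus lftrace_Gamma oppr0 add0r val_ep val_em dorfmanC.
rewrite -dualN -piplus_dorfman !piplusE //.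
by rewrite linearN -opprD scalerN.
Qed.

Let RCminusE x y : RCminus H delta (ep x) (em y) =
  - delta (Gminus y x, - flat g (Gminus y x)).
Proof.
rewrite /RCminus lftrace_Gamma oppr0 add0r val_ep val_em dorfmanC.
rewrite -dualN -piminus_dorfman !piminusE //.
by rewrite linearN -opprD scalerN.
Qed.

Lemma cross_t x : cross x t = 0.
Proof.
by rewrite /cross eta_t scale1r liexx scaler0 subr0 lieC addNr.
Qed.

(** For [sg] equal to 1 or -1 this is [delta] on the lift of [x] to E_+ or E_-; [sg = eps] is the
    lift that survives in the criterion. *)
Let dp (sg : F) x : F := delta (x, sg *: flat g x).

Let dpE sg x : dp sg x = delta (x, 0) + sg * delta (0, flat g x).
Proof. exact: dual_pairE. Qed.

Let dp_comb sg k x m y : dp sg (k *: x - m *: y) = k * dp sg x - m * dp sg y.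
Proof.
rewrite /dp -!dualZ -dualB; congr (delta _).
apply: injective_projections => //=.
have -> : flat g (k *: x - m *: y) = k *: flat g x - m *: flat g y.
  by rewrite linearB; congr (_ - _); rewrite linearZ.
by rewrite scalerBr !scalerA [sg * k]mulrC [sg * m]mulrC.
Qed.

Let dp0 sg : dp sg 0 = 0.
Proof. by have := dp_comb sg 0 0 0 0; rewrite !scale0r subr0 !mul0r subr0. Qed.

(** The weight (1 + eps)/2 absorbs a factor [eps], so under it [dp 1] may be replaced by [dp eps].
    In [dp_Gminus] the weight (1 - eps)/2 does the same for [dp (-1)]. *)
Let dp_Gplus x y : dp 1 (Gplus x y) =
  (1 + eps) / 2 * dp eps (cross x y) - (eta y : F) * dp 1 (lie t x).
Proof.
rewrite dp_comb !dpE; congr (_ - _).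
have eq1 : (1 + eps) / 2 * eps = (1 + eps) / 2.
  by rewrite mulrAC mulrDl eps2; ring.
by rewrite [LHS]mulrDr [RHS]mulrDr !mulrA eq1 mulr1.
Qed.

Let dp_Gminus y x : dp (-1) (Gminus y x) =
  (1 - eps) / 2 * dp eps (cross y x) - (eta x : F) * dp (-1) (lie t y).
Proof.
rewrite dp_comb !dpE; congr (_ - _).
have eq1 : (1 - eps) / 2 * eps = - ((1 - eps) / 2).
  by rewrite mulrAC mulrBl eps2; ring.
by rewrite [LHS]mulrDr [RHS]mulrDr !mulrA eq1 mulrN1.
Qed.

Lemma gen_einsteinP : gen_einstein H g delta <->
  (forall x y, delta (cross x y, eps *: flat g (cross x y)) = 0) /\
  (forall x, delta (lie t x, 0) = 0 /\ delta (0, flat g (lie t x)) = 0).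
Proof.
have -> : gen_einstein H g delta <->
    forall x y, dp 1 (Gplus x y) = 0 /\ dp (-1) (Gminus y x) = 0.
  split=> [[RCp RCm] x y|dpG].
    split; apply: oppr_inj; rewrite oppr0 /dp ?scale1r ?scaleN1r.
      by rewrite -RCplusE RCp.
    by rewrite -RCminusE RCm.
  split=> [v u|u v]; have [x ->] := ep_onto u; have [y ->] := em_onto v.
    by have [] := dpG x y; rewrite /dp scale1r RCplusE => -> _; rewrite oppr0.
  by have [] := dpG x y; rewrite /dp scaleN1r RCminusE => _ ->; rewrite oppr0.
split=> [dpG|[dc dl] x y]; last first.
  rewrite dp_Gplus dp_Gminus /dp !dc.
  have [] := dl x; have [] := dl y => dly1 dly2 dlx1 dlx2.
  by rewrite -!/(dp _ _) !dpE dly1 dly2 dlx1 dlx2; split; ring.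
(* Taking [t] as one argument kills the [cross] term and isolates D. *)
have dl1 x : dp 1 (lie t x) = 0.
  have [] := dpG x t; rewrite dp_Gplus cross_t dp0 eta_t.
  by rewrite mulr0 sub0r mul1r => /eqP; rewrite oppr_eq0 => /eqP.
have dl2 x : dp (-1) (lie t x) = 0.
  have [] := dpG t x; rewrite dp_Gminus cross_t dp0 eta_t.
  by rewrite mulr0 sub0r mul1r => _ /eqP; rewrite oppr_eq0 => /eqP.
split=> x.
  move=> y; rewrite -/(dp _ _).
  (* The swapped arguments make both equations concern [cross x y], with weights (1 + eps)/2 and (1
     - eps)/2, whose sum is 1. *)
  have [+ _] := dpG x y; have [_ +] := dpG y x.
  rewrite dp_Gplus dp_Gminus dl1 dl2 !mulr0 !subr0 => dm dplus.
  rewrite -[LHS]mul1r.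
  have -> : 1 = (1 + eps) / 2 + (1 - eps) / 2 by field.
  by rewrite mulrDl dm dplus addr0.
have := dl1 x; have := dl2 x; rewrite !dpE mul1r mulN1r => am ap.
(* Twice the two values are the sum and the difference of [ap] and [am]. *)
split; apply: (mulfI two_neq0); rewrite mulr0.
  rewrite -[RHS]addr0 -{1}am -ap; ring.
rewrite -[RHS]subr0 -{2}am -ap; ring.
Qed.
End Ricci.

(** * Coordinates in an orthonormal frame with signs [s1], [s2], [s3] *)

Section Frame.
Variables (F : fieldType) (V : lieAlgType F) (H : form3 V) (g : {symmetric V}).
Variables (e1 e2 e3 e4 : V) (f1 f2 f3 f4 : dual V).
(* [p], [q], [r] are the values of the skew form g (lie e4 x) y at (e1, e2),
   (e2, e3), (e3, e1): see [lie41], [lie42], [lie43]. *)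
Variables (a eps p q r s1 s2 s3 : F) (delta : dual (dbl V)).

Local Notation e := [:: e1; e2; e3; e4].
Local Notation f := [:: f1; f2; f3; f4].

Hypotheses (two_neq0 : (2 : F) != 0) (g_nondeg : nondegenerate g).
Hypotheses (a_neq0 : a != 0) (eps2 : eps * eps = 1).
Hypothesis e_basis : basis_of {:V} e.
Hypothesis e_orth :
  forall i j, (i < 4)%N -> (j < 4)%N -> i <> j -> g e`_i e`_j = 0.
Hypothesis f_dual : is_dual_basis e f.
Hypothesis H_wedge : forall x y z, H x y z = a * wedge3 f1 f2 f3 x y z.
Hypotheses (g11 : g e1 e1 = s1) (g22 : g e2 e2 = s2).
Hypothesis g33 : g e3 e3 = s3.
Hypotheses (s1s1 : s1 * s1 = 1) (s2s2 : s2 * s2 = 1) (s3s3 : s3 * s3 = 1).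
Hypothesis lie12 : lie e1 e2 = (s3 * eps * a) *: e3.
Hypothesis lie23 : lie e2 e3 = (s1 * eps * a) *: e1.
Hypothesis lie31 : lie e3 e1 = (s2 * eps * a) *: e2.
Hypothesis lie41 : lie e4 e1 = (s2 * p) *: e2 - (s3 * r) *: e3.
Hypothesis lie42 : lie e4 e2 = (s3 * q) *: e3 - (s1 * p) *: e1.
Hypothesis lie43 : lie e4 e3 = (s1 * r) *: e1 - (s2 * q) *: e2.

Let f1E : ((f1 e1 = 1 :> F) * (f1 e2 = 0 :> F))
  * ((f1 e3 = 0 :> F) * (f1 e4 = 0 :> F)).
Proof.
by have [_ d] := f_dual; split; split;
  [exact: (d 0 0) | exact: (d 0 1) | exact: (d 0 2) | exact: (d 0 3)].
Qed.
Let f2E : ((f2 e1 = 0 :> F) * (f2 e2 = 1 :> F))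
  * ((f2 e3 = 0 :> F) * (f2 e4 = 0 :> F)).
Proof.
by have [_ d] := f_dual; split; split;
  [exact: (d 1 0) | exact: (d 1 1) | exact: (d 1 2) | exact: (d 1 3)].
Qed.
Let f3E : ((f3 e1 = 0 :> F) * (f3 e2 = 0 :> F))
  * ((f3 e3 = 1 :> F) * (f3 e4 = 0 :> F)).
Proof.
by have [_ d] := f_dual; split; split;
  [exact: (d 2 0) | exact: (d 2 1) | exact: (d 2 2) | exact: (d 2 3)].
Qed.
Let f4E : ((f4 e1 = 0 :> F) * (f4 e2 = 0 :> F))
  * ((f4 e3 = 0 :> F) * (f4 e4 = 1 :> F)).
Proof.
by have [_ d] := f_dual; split; split;
  [exact: (d 3 0) | exact: (d 3 1) | exact: (d 3 2) | exact: (d 3 3)].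
Qed.
Let fE := (f1E, f2E, f3E, f4E).

Lemma frame_expand x :
  x = (f1 x : F) *: e1 + (f2 x : F) *: e2 + (f3 x : F) *: e3 + (f4 x : F) *: e4.
Proof.
have [c1 [c2 [c3 [c4 ->]]]] : exists c1 c2 c3 c4 : F,
    x = c1 *: e1 + c2 *: e2 + c3 *: e3 + c4 *: e4.
  have := @coord_basis _ _ _ 4 [tuple e1; e2; e3; e4] x e_basis (memvf x).
  rewrite !big_ord_recl big_ord0 addr0 /= => ->.
  by do 4 eexists; rewrite !addrA.
by rewrite !dualE !fE !mulr1 !mulr0 !addr0 !add0r.
Qed.

Lemma frame_inj x y :
  [/\ f1 x = f1 y, f2 x = f2 y, f3 x = f3 y & f4 x = f4 y] -> x = y.
Proof.
by case=> h1 h2 h3 h4; rewrite (frame_expand x) h1 h2 h3 h4 -frame_expand.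
Qed.

Let g_e1 x : g e1 x = s1 * f1 x.
Proof.
rewrite {1}(frame_expand x) !linearD !linearZ /= g11.
by rewrite (e_orth (i := 0) (j := 1)) // (e_orth (i := 0) (j := 2)) //
  (e_orth (i := 0) (j := 3)) //; ring.
Qed.
Let g_e2 x : g e2 x = s2 * f2 x.
Proof.
rewrite {1}(frame_expand x) !linearD !linearZ /= g22.
by rewrite (e_orth (i := 1) (j := 0)) // (e_orth (i := 1) (j := 2)) //
  (e_orth (i := 1) (j := 3)) //; ring.
Qed.
Let g_e3 x : g e3 x = s3 * f3 x.
Proof.
rewrite {1}(frame_expand x) !linearD !linearZ /= g33.
by rewrite (e_orth (i := 2) (j := 0)) // (e_orth (i := 2) (j := 1)) //
  (e_orth (i := 2) (j := 3)) //; ring.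
Qed.

Let lie_e4 x : lie e4 x =
  (f1 x : F) *: lie e4 e1 + (f2 x : F) *: lie e4 e2 + (f3 x : F) *: lie e4 e3.
Proof. by rewrite {1}(frame_expand x) !lieDr !lieZr liexx scaler0 addr0. Qed.

(** Applying a linear form [phi] turns the expansion of a bracket into an identity in [F], within
    reach of [ring]. *)
Lemma lie_frame (phi : dual V) x y : phi (lie x y) = 
  (f1 x * f2 y - f2 x * f1 y) * phi (lie e1 e2)
  + (f2 x * f3 y - f3 x * f2 y) * phi (lie e2 e3)
  + (f3 x * f1 y - f1 x * f3 y) * phi (lie e3 e1)
  + f4 x * phi (lie e4 y) - f4 y * phi (lie e4 x) :> F.
Proof.
rewrite (lie_e4 x) (lie_e4 y) {1}(frame_expand x) {1}(frame_expand y).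
rewrite !lieDl !lieDr !lieZr !lieZl !liexx.
rewrite (lieC e2 e1) (lieC e3 e2) (lieC e1 e3).
rewrite (lieC e1 e4) (lieC e2 e4) (lieC e3 e4) !dualE.
ring.
Qed.

Let dual_cross (phi : dual V) x y : phi (cross e4 f4 x y) =
  eps * a * ((f1 x * f2 y - f2 x * f1 y) * s3 * phi e3
    + (f2 x * f3 y - f3 x * f2 y) * s1 * phi e1
    + (f3 x * f1 y - f1 x * f3 y) * s2 * phi e2) :> F.
Proof.
rewrite /cross !dualE lie_frame lie12 lie23 lie31 !dualE; ring.
Qed.

(** Read this way, [g] is a linear form in its first argument, to which [dual_cross] and [dualE]
    apply. *)
Let g_flat x y : g x y = flat g y x.
Proof. by rewrite flatE (g_sym g). Qed.

Let H_cross x y z : H x y z = eps * g (cross e4 f4 x y) z.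
Proof.
rewrite g_flat dual_cross -!g_flat g_e1 g_e2 g_e3 H_wedge wedge3E.
rewrite !mulrA eps2 mul1r -![_ * s1 * s1]mulrA -![_ * s2 * s2]mulrA.
rewrite -![_ * s3 * s3]mulrA s1s1 s2s2 s3s3; ring.
Qed.

(** The squared signs cancel, leaving the skew matrix with entries [p], [q], [r]. *)
Let skew x y : g (lie e4 x) y = - g x (lie e4 y).
Proof.
rewrite (g_sym g x) 2!g_flat (lie_e4 x) (lie_e4 y) lie41 lie42 lie43.
rewrite !dualE -!g_flat !g_e1 !g_e2 !g_e3.
have sq (s u v : F) : s * s = 1 -> s * u * (s * v) = u * v.
  by move=> ss; rewrite mulrACA ss mul1r.
by rewrite !sq //; ring.
Qed.

Let eta_lie x y : f4 (lie x y) = 0.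
Proof.
rewrite lie_frame (lie_e4 x) (lie_e4 y) lie12 lie23 lie31 lie41 lie42 lie43.
by rewrite !dualE !fE; ring.
Qed.


Lemma cross_frame x y : cross e4 f4 x y =
  (eps * a * (f2 x * f3 y - f3 x * f2 y) * s1) *: e1
  + (eps * a * (f3 x * f1 y - f1 x * f3 y) * s2) *: e2
  + (eps * a * (f1 x * f2 y - f2 x * f1 y) * s3) *: e3.
Proof.
by apply: frame_inj; split; rewrite dual_cross !dualE !fE; ring.
Qed.

Lemma lie_e4_frame x : lie e4 x =
  (s1 * (r * f3 x - p * f2 x)) *: e1 + (s2 * (p * f1 x - q * f3 x)) *: e2
  + (s3 * (q * f2 x - r * f1 x)) *: e3.
Proof.
by apply: frame_inj; split;
  rewrite lie_e4 lie41 lie42 lie43 !dualE !fE; ring.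
Qed.

Lemma flat_frame c1 c2 c3 : flat g (c1 *: e1 + c2 *: e2 + c3 *: e3) =
  (c1 * s1) *: f1 + (c2 * s2) *: f2 + (c3 * s3) *: f3.
Proof.
apply/lfunP => x.
rewrite flatE !linearDl !linearZl /= g_e1 g_e2 g_e3 !mulrA.
by rewrite !add_lfunE !scale_lfunE.
Qed.

(** * The Einstein criterion in frame coordinates *)

Let al x : F := delta (x, 0).
Let be (xi : dual V) : F := delta (0, xi).

Let alZ k x : al (k *: x) = k * al x.
Proof.
rewrite /al -dualZ; congr (delta _).
by apply: injective_projections; rewrite /= ?scaler0.
Qed.
Let alD x y : al (x + y) = al x + al y.
Proof.
rewrite /al -dualD; congr (delta _).
by apply: injective_projections; rewrite /= ?addr0.
Qed.
Let beZ k xi : be (k *: xi) = k * be xi.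
Proof.
rewrite /be -dualZ; congr (delta _).
by apply: injective_projections; rewrite /= ?scaler0.
Qed.
Let beD xi xi' : be (xi + xi') = be xi + be xi'.
Proof.
rewrite /be -dualD; congr (delta _).
by apply: injective_projections; rewrite /= ?addr0.
Qed.

(** The invariant criterion is tested on frame vectors: [cross] of two of [e1], [e2], [e3] is a
    multiple of the third, and D at each of them gives one equation for vectors and one for
    covectors. The covector equations carry no signs because [flat] contributes each sign a second
    time. *)
Lemma gen_einstein_frame : gen_einstein H g delta <->
  [/\ [/\ delta (e1, (eps * s1) *: f1) = 0, delta (e2, (eps * s2) *: f2) = 0
         & delta (e3, (eps * s3) *: f3) = 0],
      [/\ s2 * p * delta (e2, 0) = s3 * r * delta (e3, 0),
          s3 * q * delta (e3, 0) = s1 * p * delta (e1, 0)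
        & s1 * r * delta (e1, 0) = s2 * q * delta (e2, 0)]
    & [/\ p * delta (0, f2) = r * delta (0, f3),
          q * delta (0, f3) = p * delta (0, f1)
        & r * delta (0, f1) = q * delta (0, f2)]].
Proof.
rewrite (gen_einsteinP delta two_neq0 g_nondeg eps2 H_cross skew eta_lie
  f4E.2.2).
have al_frame c1 c2 c3 : delta (c1 *: e1 + c2 *: e2 + c3 *: e3, 0) =
    c1 * al e1 + c2 * al e2 + c3 * al e3 by rewrite -/(al _) !alD !alZ.
have be_frame c1 c2 c3 :
    delta (0, flat g (c1 *: e1 + c2 *: e2 + c3 *: e3)) =
    c1 * s1 * be f1 + c2 * s2 * be f2 + c3 * s3 * be f3.
  by rewrite flat_frame -/(be _) !beD !beZ.
have pairE c1 c2 c3 : delta (c1 *: e1 + c2 *: e2 + c3 *: e3,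
      eps *: flat g (c1 *: e1 + c2 *: e2 + c3 *: e3)) =
    c1 * delta (e1, (eps * s1) *: f1) + c2 * delta (e2, (eps * s2) *: f2)
    + c3 * delta (e3, (eps * s3) *: f3).
  rewrite !dual_pairE al_frame be_frame /al /be.
  ring.
have al_ad x : delta (lie e4 x, 0) =
    f1 x * (s2 * p * al e2 - s3 * r * al e3)
    + f2 x * (s3 * q * al e3 - s1 * p * al e1)
    + f3 x * (s1 * r * al e1 - s2 * q * al e2) :> F.
  by rewrite lie_e4_frame al_frame; ring.
have be_ad x : delta (0, flat g (lie e4 x)) =
    f1 x * (p * be f2 - r * be f3) + f2 x * (q * be f3 - p * be f1)
    + f3 x * (r * be f1 - q * be f2) :> F.
  rewrite lie_e4_frame be_frame ![_ * _ * s1]mulrAC ![_ * _ * s2]mulrAC.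
  by rewrite ![_ * _ * s3]mulrAC s1s1 s2s2 s3s3; ring.
(* These are the coefficients of [cross] on the frame, to be cancelled below. *)
have nz s : s * s = 1 -> eps * a * s != 0.
  move=> ss; rewrite !mulf_neq0 //.
    by apply: contra_eq_neq eps2 => ->; rewrite mul0r eq_sym oner_eq0.
  by apply: contra_eq_neq ss => ->; rewrite mul0r eq_sym oner_eq0.
split=> [[dc dl]|[[d1 d2 d3] [a1 a2 a3] [b1 b2 b3]]]; last first.
  split=> [x y|x].
    by rewrite cross_frame pairE d1 d2 d3 !mulr0 !addr0.
  rewrite al_ad be_ad /al /be a1 a2 a3 b1 b2 b3.
  by rewrite !subrr !mulr0 !addr0.
split; split.
- have := dc e2 e3; rewrite cross_frame pairE !fE => dc23.
  by apply: (mulfI (nz _ s1s1)); rewrite mulr0 -[RHS]dc23; ring.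
- have := dc e3 e1; rewrite cross_frame pairE !fE => dc31.
  by apply: (mulfI (nz _ s2s2)); rewrite mulr0 -[RHS]dc31; ring.
- have := dc e1 e2; rewrite cross_frame pairE !fE => dc12.
  by apply: (mulfI (nz _ s3s3)); rewrite mulr0 -[RHS]dc12; ring.
- have [+ _] := dl e1; rewrite al_ad !fE => dl1.
  by apply: subr0_eq; rewrite -[RHS]dl1 /al; ring.
- have [+ _] := dl e2; rewrite al_ad !fE => dl2.
  by apply: subr0_eq; rewrite -[RHS]dl2 /al; ring.
- have [+ _] := dl e3; rewrite al_ad !fE => dl3.
  by apply: subr0_eq; rewrite -[RHS]dl3 /al; ring.
- have [_ +] := dl e1; rewrite be_ad !fE => dl1.
  by apply: subr0_eq; rewrite -[RHS]dl1 /be; ring.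
- have [_ +] := dl e2; rewrite be_ad !fE => dl2.
  by apply: subr0_eq; rewrite -[RHS]dl2 /be; ring.
- have [_ +] := dl e3; rewrite be_ad !fE => dl3.
  by apply: subr0_eq; rewrite -[RHS]dl3 /be; ring.
Qed.

End Frame.

(** * The four families as values of [p], [q], [r] and the signs *)

Theorem corollary5p13 (R : realType) (V : lieAlgType R) (H : form3 V)
    (g : {symmetric V}) (e1 e2 e3 e4 : V) (f1 f2 f3 f4 : dual V)
    (a eps : R) (delta : dual (dbl V)) :
  gen_lorentzian H g ->
  \dim {:V} = 4%N ->
  basis_of {:V} [:: e1; e2; e3; e4] ->
  pseudo_orthonormal g [:: e1; e2; e3; e4] ->
  is_dual_basis [:: e1; e2; e3; e4] [:: f1; f2; f3; f4] ->
  a <> 0 ->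
  eps = -1 \/ eps = 1 ->
  (forall x y z, H x y z = a * wedge3 f1 f2 f3 x y z) ->
  [/\
   (* (a) *)
   forall b : R,
     [/\ g e1 e1 = 1, g e2 e2 = 1, g e3 e3 = 1 & g e4 e4 = -1] ->
     [/\ lie e1 e2 = (eps * a) *: e3,
         lie e2 e3 = (eps * a) *: e1 &
         lie e3 e1 = (eps * a) *: e2] ->
     [/\ lie e3 e4 = b *: e2,
         lie e4 e2 = b *: e3 &
         lie e4 e1 = 0] ->
     gen_einstein H g delta <->
       (b <> 0 /\
        [/\ delta (e2, 0) = 0, delta (e3, 0) = 0,
            delta (0, f2) = 0, delta (0, f3) = 0 &
            delta (e1, eps *: f1) = 0])
       \/
       (b = 0 /\
        [/\ delta (e1, eps *: f1) = 0,
            delta (e2, eps *: f2) = 0 &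
            delta (e3, eps *: f3) = 0])
  &
   (* (b)-(d) *)
     [/\ g e1 e1 = -1, g e2 e2 = 1, g e3 e3 = 1 & g e4 e4 = 1] ->
     [/\ lie e1 e2 = (eps * a) *: e3,
         lie e2 e3 = - (eps * a) *: e1 &
         lie e3 e1 = (eps * a) *: e2] ->
     [/\
      (* (b) *)
      forall b : R,
        [/\ lie e4 e2 = b *: e3,
            lie e4 e3 = - b *: e2 &
            lie e4 e1 = 0] ->
        gen_einstein H g delta <->
          (b <> 0 /\
           [/\ delta (e2, 0) = 0, delta (e3, 0) = 0,
               delta (0, f2) = 0, delta (0, f3) = 0 &
               delta (e1, - eps *: f1) = 0])
          \/
          (b = 0 /\
           [/\ delta (e2, eps *: f2) = 0,
               delta (e3, eps *: f3) = 0 &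
               delta (e1, - eps *: f1) = 0]),
      (* (c) *)
      forall b : R,
        b <> 0 ->
        [/\ lie e4 e1 = b *: e2,
            lie e4 e2 = b *: e1 &
            lie e4 e3 = 0] ->
        gen_einstein H g delta <->
          [/\ delta (e1, 0) = 0, delta (e2, 0) = 0,
              delta (0, f1) = 0, delta (0, f2) = 0 &
              delta (e3, eps *: f3) = 0]
    &
      (* (d) *)
        [/\ lie e4 e1 = e2,
            lie e4 e2 = e1 + e3 &
            lie e4 e3 = - e2] ->
        gen_einstein H g delta <->
          [/\ delta (e2, 0) = 0, delta (0, f2) = 0,
              delta (e3, 0) = - delta (e1, 0),
              delta (0, f3) = delta (0, f1) &
              delta (e1, - eps *: f1) = 0]]].
Proof.
move=> [[_ g_nondeg] _] _ e_basis [_ e_orth] f_dual /eqP a_neq0 eps_pm1 H_wedge.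
have two_neq0 : (2 : R) != 0 by rewrite Num.Theory.pnatr_eq0.
have eps2 : eps * eps = 1 by case: eps_pm1 => ->; rewrite ?mulrNN mulr1.
have sqN1 : -1 * -1 = 1 :> R by rewrite mulrNN mulr1.
have einstein := gen_einstein_frame delta two_neq0 g_nondeg a_neq0 eps2 e_basis
  e_orth f_dual H_wedge.
have rot (b : R) : b * delta (e3, 0) = 0 -> 0 = b * delta (e2, 0) ->
    b * delta (0, f3) = 0 -> 0 = b * delta (0, f2) -> b != 0 ->
    [/\ delta (e2, 0) = 0, delta (e3, 0) = 0, delta (0, f2) = 0
      & delta (0, f3) = 0].
  move=> h1 /esym h2 h3 /esym h4 b_neq0.
  by split; apply: (mulfI b_neq0); rewrite mulr0.
split=> [b [g11 g22 g33 _] [l12 l23 l31] [l34 l42 l41]|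
    [g11 g22 g33 _] [l12 l23 l31]].
  (* Family (a): D rotates the plane of [e2] and [e3], so only [q = b] remains. *)
  rewrite (einstein 0 b 0 _ _ _ g11 g22 g33) ?mulr1 ?mul1r ?mulr0 ?scale0r
    ?subr0 ?sub0r ?oppr0 // 1?lieC ?l34 //.
  rewrite !mul0r; split=> [[[d1 d2 d3] [_ h1 h2] [_ h3 h4]]|].
    case: (eqVneq b 0) => [b0|b_neq0]; first by right.
    by left; split; [exact/eqP | have [] := rot b h1 h2 h3 h4 b_neq0].
  case=> [[_ [h2 h3 h4 h5 d1]]|[-> [d1 d2 d3]]]; last by rewrite !mul0r.
  (* The conditions at [e2] and [e3] follow from the vanishing of both components. The pair at [e1]
     is split as well and is reassembled to match [d1]. *)
  rewrite h2 h3 h4 h5 !mulr0 !dual_pairE h2 h3 h4 h5 !mulr0 !addr0.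
  by rewrite -dual_pairE.
have l12' : lie e1 e2 = (1 * eps * a) *: e3 by rewrite mul1r.
have l23' : lie e2 e3 = (-1 * eps * a) *: e1 by rewrite mulN1r mulNr.
have l31' : lie e3 e1 = (1 * eps * a) *: e2 by rewrite mul1r.
have {}einstein := fun p q r => einstein p q r _ _ _ g11 g22 g33
  sqN1 (mulr1 1) (mulr1 1) l12' l23' l31'.
split=> [b [l42 l43 l41]|b /eqP b_neq0 [l41 l42 l43]|[l41 l42 l43]].
(* Family (b): the same rotation, now with [e1] timelike. *)
- rewrite (einstein 0 b 0) ?mulr1 ?mul1r ?mulr0 ?scale0r ?subr0 ?sub0r ?oppr0
    ?mulN1r ?mulrN1 ?mulNr -?scaleNr //.
  rewrite !mul0r; split=> [[[d1 d2 d3] [_ h1 h2] [_ h3 h4]]|].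
    case: (eqVneq b 0) => [b0|b_neq0]; first by right.
    by left; split; [exact/eqP | have [] := rot b h1 h2 h3 h4 b_neq0].
  case=> [[_ [h2 h3 h4 h5 d1]]|[-> [d2 d3 d1]]]; last by rewrite !mul0r.
  rewrite h2 h3 h4 h5 !mulr0 !dual_pairE h2 h3 h4 h5 !mulr0 !addr0.
  by rewrite -dual_pairE.
(* Family (c): D is a boost in the plane of [e1] and [e2], so [p = b]. *)
- rewrite (einstein b 0 0) ?mulr1 ?mul1r ?mulr0 ?scale0r ?subr0 ?sub0r ?oppr0
    ?mulN1r ?mulrN1 ?mulNr ?scaleNr ?opprK //.
  rewrite -scaleNr !mul0r; split=> [[[_ _ d3] [h1 h2 _] [h3 /esym h4 _]]|].
    move/esym/eqP in h2; rewrite oppr_eq0 in h2.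
    by split=> //; apply: (mulfI b_neq0); rewrite mulr0 //; apply/eqP.
  move=> [h1 h2 h3 h4 d3].
  by rewrite !dual_pairE h1 h2 h3 h4 !mulr0 !addr0 oppr0 -dual_pairE d3.
(* Family (d): D is a null rotation, sending [e1] to [e2], [e2] to the null vector [e1 + e3], and
   that vector to 0; thus [p = q = 1]. *)
- rewrite (einstein 1 1 0) ?mulr1 ?mul1r ?mulr0 ?scale0r ?subr0 ?sub0r ?oppr0
    ?mulN1r ?mulrN1 ?mulNr ?scaleNr ?opprK ?scale1r ?(addrC e3) //.
  rewrite -scaleNr !mul0r.
  split=> [[[d1 d2 d3] [h1 h2 _] [h3 h4 _]]|[h1 h2 h3 h4 d1]]; first by split.
  (* By [h3] and [h4] the value at [e3] is the negative of the value at [e1]. *)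
  have d3 : delta (e3, eps *: f3) = 0.
    by rewrite dual_pairE h3 h4; apply: oppr_inj; rewrite oppr0 -[RHS]d1
      dual_pairE opprD opprK -mulNr.
  by rewrite d1 d3 dual_pairE h1 h2 mulr0 addr0.
Qed.
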